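(* Let $(P_l)_{l\ge 0}$ be the Pell sequence. The only repdigits (in base $10$) which are differences $P_n-P_m$ of two Pell numbers with integers $n>m\ge 1$ are $$1,\ 3,\ 4,\ 7,\ 11\ \text{ and }\ 99.$$ Moreover, $P_2-P_1=1$, $P_3-P_2=3$, $P_3-P_1=4$, $P_4-P_3=7$, $P_4-P_1=11$ and $P_7-P_6=99$.
   Context: The Pell sequence is defined by $P_0=0$, $P_1=1$ and $P_{l+1}=2P_l+P_{l-1}$ for $l\ge 1$. A repdigit in base $10$ is an integer of the form $a\cdot\frac{10^k-1}{9}$ with integers $k\ge 1$ and $1\le a\le 9$ (so one-digit positive integers are included). *)

(* Defs.v *)
From Stdlib Require Import ZArith List.
Import ListNotations.
Open Scope Z_scope.

Fixpoint pell (l : nat) : Z :=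
  match l with
  | O => 0
  | S l' => match l' with
            | O => 1
            | S l'' => 2 * pell l' + pell l''
            end
  end.

(* The division is exact: 9 divides 10 ^ k - 1. *)
Definition repdigit (N : Z) : Prop :=
  exists a k : Z, 1 <= k /\ 1 <= a <= 9 /\ N = a * ((10 ^ k - 1) / 9).

Definition pell_difference (N : Z) : Prop :=
  exists n m : nat, (1 <= m < n)%nat /\ N = pell n - pell m.

(* Main.v *)
Require Import Defs.
From Stdlib Require Import ZArith List.
From Stdlib Require Import Lia.
Import ListNotations.
Open Scope Z_scope.

(** Write a repdigit as [a * repunit k], where [repunit k] is the integer with
    [k] digits 1.

    Short repdigits, [k <= 3], are at most 999, while [P_n - P_m >= P_{n-1}]
    exceeds 999 as soon as [n > 10]; so only finitely many pairs of indices
    compete with these, and they are enumerated ([short_differences]).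

    Long repdigits, [k >= 4], are never differences of Pell numbers, and
    congruences alone show it.  Modulo an integer [M] the Pell sequence is
    periodic, and so is [repunit] from index 4 on if neither [2 ^ 5] nor
    [5 ^ 5] divides [M], since [10 ^ k] then vanishes modulo the parts of [M]
    at the primes 2 and 5.
    Whether [P_n - P_m = a * repunit (4 + k)] is solvable modulo [M] therefore
    depends only on [a] and on residues of [n], [m], [k], and suitable moduli
    exist because many small primes have short periods for both sequences:
    - modulo [8 * 3 * 5 * 7 * 11] the Pell sequence has period 24 and the
      repunits have period 6; only seven classes [(a, n, m, k)] survive
      ([first_sieve]), all of them with [a = 2] or [a = 4];
    - modulo [16 * 17 * 73] the periods are 144 and (a divisor of) 48, multiples
      of the former ones; none of the lifts of the seven classes survives
      ([second_sieve]).
    The genuine solutions satisfy every congruence, so such an argument must use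
    a property that their repunits lack: here it is [k >= 4], which makes
    [repunit k] congruent to [-1/9] modulo 16. *)

(** * The Pell sequence *)

(** Unlike [pell], whose double recursive call is exponential to evaluate, this
    lists consecutive terms in linear time. *)
Fixpoint pell_terms (x y : Z) (len : nat) : list Z :=
  match len with
  | O => []
  | S len' => x :: pell_terms y (2 * y + x) len'
  end.

Lemma nth_pell_terms (len s n : nat) : (n < len)%nat ->
  nth n (pell_terms (pell s) (pell (S s)) len) 0 = pell (s + n).
Proof.
  revert s n; induction len as [|len IH]; intros s n Hn; [lia|].
  cbn [pell_terms]; destruct n as [|n]; cbn [nth].
  - now rewrite Nat.add_0_r.
  - change (2 * pell (S s) + pell s) with (pell (S (S s))).
    rewrite IH by lia. f_equal; lia.
Qed.

Lemma nth_pell_table (len n : nat) : (n < len)%nat ->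
  nth n (pell_terms 0 1 len) 0 = pell n.
Proof. exact (nth_pell_terms len 0 n). Qed.

(** Two consecutive terms determine all later ones, so the sequence repeats
    modulo [M] as soon as its two initial values recur. *)
Lemma pell_periodic (M : Z) (L : nat) :
  (M | pell L) -> (M | pell (S L) - 1) ->
  forall n, (M | pell (n + L) - pell n).
Proof.
  intros H0 H1.
  assert (H : forall n, (M | pell (n + L) - pell n)
                        /\ (M | pell (S n + L) - pell (S n))).
  { induction n as [|n [IH0 IH1]].
    - change (0 + L)%nat with L; change (1 + L)%nat with (S L).
      split; [now rewrite Z.sub_0_r | exact H1].
    - split; [exact IH1|].
      change (pell (S (S n) + L)) with (2 * pell (S n + L) + pell (n + L)).
      change (pell (S (S n))) with (2 * pell (S n) + pell n).
      replace (_ - _) with (2 * (pell (S n + L) - pell (S n))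
                            + (pell (n + L) - pell n)) by ring.
      now apply Z.divide_add_r; [apply Z.divide_mul_r|]. }
  intro n; apply H.
Qed.

Lemma pell_nonneg (n : nat) : 0 <= pell n /\ 0 <= pell (S n).
Proof.
  induction n as [|n [H0 H1]]; [now cbn|]; split; [exact H1|].
  change (pell (S (S n))) with (2 * pell (S n) + pell n); lia.
Qed.

Lemma pell_step (n : nat) : 2 * pell n <= pell (S n).
Proof.
  destruct n as [|n]; [now cbn|].
  change (pell (S (S n))) with (2 * pell (S n) + pell n).
  pose proof (pell_nonneg n); lia.
Qed.

Lemma pell_mono (m n : nat) : (m <= n)%nat -> pell m <= pell n.
Proof.
  induction 1 as [|n _ IH]; [lia|].
  pose proof (pell_step n); pose proof (pell_nonneg n); lia.
Qed.

(** * Repunits *)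

Fixpoint repunit (k : nat) : Z :=
  match k with
  | O => 0
  | S k' => 10 * repunit k' + 1
  end.

Lemma repunit_closed_form (k : nat) : (10 ^ Z.of_nat k - 1) / 9 = repunit k.
Proof.
  assert (H : 10 ^ Z.of_nat k - 1 = repunit k * 9).
  { induction k as [|k IH]; [reflexivity|].
    rewrite Nat2Z.inj_succ, Z.pow_succ_r by lia. cbn [repunit]. lia. }
  rewrite H. apply Z.div_mul. lia.
Qed.

Lemma repdigit_repunit (N : Z) : repdigit N ->
  exists (a : Z) (k : nat), 1 <= a <= 9 /\ (1 <= k)%nat /\ N = a * repunit k.
Proof.
  intros (a & k & Hk & Ha & ->). exists a, (Z.to_nat k).
  rewrite <- repunit_closed_form, Z2Nat.id by lia.
  repeat split; lia.
Qed.

(** The start [s] allows for moduli with a factor 2 or 5, modulo which the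
    sequence is periodic only from some index on. *)
Lemma repunit_periodic (M : Z) (s K : nat) :
  (M | repunit (s + K) - repunit s) ->
  forall k, (M | repunit (s + (k + K)) - repunit (s + k)).
Proof.
  intros H k; induction k as [|k IH].
  - now rewrite Nat.add_0_r.
  - rewrite <- plus_n_Sm, Nat.add_succ_l, <- plus_n_Sm. cbn [repunit].
    replace (_ - _) with (10 * (repunit (s + (k + K)) - repunit (s + k))) by ring.
    now apply Z.divide_mul_r.
Qed.

(** * Sieving residue classes *)

Lemma reduce_index (f : nat -> Z) (M : Z) (L : nat) :
  (forall n, (M | f (n + L)%nat - f n)) ->
  forall n, (M | f n - f (n mod L)%nat).
Proof.
  intros H n.
  assert (Hq : forall r q, (M | f (r + q * L)%nat - f r)).
  { intros r; induction q as [|q IH].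
    - rewrite Nat.add_0_r, Z.sub_diag. apply Z.divide_0_r.
    - replace (r + S q * L)%nat with (r + q * L + L)%nat by lia.
      replace (_ - _) with
        ((f (r + q * L + L)%nat - f (r + q * L)%nat)
         + (f (r + q * L)%nat - f r)) by ring.
      now apply Z.divide_add_r. }
  pose proof (Hq (n mod L)%nat (n / L)%nat) as Hn.
  replace (n mod L + n / L * L)%nat with n in Hn; [exact Hn|].
  pose proof (Nat.div_mod_eq n L); lia.
Qed.

(** A class [(a, n, m, k)] stands for the equation
    [pell n - pell m = a * repunit (4 + k)]. *)
Definition solvable_mod (M : Z) (P : list Z) (c : Z * nat * nat * nat) : bool :=
  let '(a, n, m, k) := c in
  (nth n P 0 - nth m P 0 - a * repunit (4 + k)) mod M =? 0.

Definition sieve (M : Z) (L : nat) (cs : list (Z * nat * nat * nat)) :=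
  filter (solvable_mod M (pell_terms 0 1 L)) cs.

Definition classes (L K : nat) : list (Z * nat * nat * nat) :=
  list_prod (list_prod (list_prod [1; 2; 3; 4; 5; 6; 7; 8; 9] (seq 0 L)) (seq 0 L))
            (seq 0 K).

(** All classes modulo [L * u] (for [n] and [m]) and [K * v] (for [k]) that
    reduce to [c]. *)
Definition lifts (L u K v : nat) (c : Z * nat * nat * nat) :=
  let '(a, n, m, k) := c in
  list_prod (list_prod (list_prod [a] (map (fun i => n + L * i)%nat (seq 0 u)))
                       (map (fun j => m + L * j)%nat (seq 0 u)))
            (map (fun l => k + K * l)%nat (seq 0 v)).

(** An actual solution is still a solution modulo [M] after its indices are
    reduced modulo the periods, so sieving never discards its class. *)
Lemma sieve_complete (M : Z) (L K : nat) (cs : list (Z * nat * nat * nat))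
    (a : Z) (n m k : nat) :
  M <> 0 -> (0 < L)%nat ->
  (forall i, (M | pell (i + L) - pell i)) ->
  (forall i, (M | repunit (4 + (i + K)) - repunit (4 + i))) ->
  pell n - pell m = a * repunit (4 + k) ->
  In (a, n mod L, m mod L, k mod K)%nat cs ->
  In (a, n mod L, m mod L, k mod K)%nat (sieve M L cs).
Proof.
  intros HM HL HP HR E Hin. apply filter_In; split; [exact Hin|].
  unfold solvable_mod. rewrite !nth_pell_table by (apply Nat.mod_upper_bound; lia).
  apply Z.eqb_eq, Z.mod_divide; [exact HM|].
  pose proof (reduce_index pell M L HP n) as Hn.
  pose proof (reduce_index pell M L HP m) as Hm.
  pose proof (reduce_index (fun i => repunit (4 + i)) M K HR k) as Hk.
  cbv beta in Hk.
  destruct Hn as [x Hx], Hm as [y Hy], Hk as [z Hz].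
  exists (y - x + a * z). nia.
Qed.

Lemma in_classes (L K : nat) (a : Z) (n m k : nat) :
  1 <= a <= 9 -> (0 < L)%nat -> (0 < K)%nat ->
  In (a, n mod L, m mod L, k mod K)%nat (classes L K).
Proof.
  intros Ha HL HK. unfold classes. repeat apply in_prod.
  - cbn; lia.
  - apply in_seq. pose proof (Nat.mod_upper_bound n L); lia.
  - apply in_seq. pose proof (Nat.mod_upper_bound m L); lia.
  - apply in_seq. pose proof (Nat.mod_upper_bound k K); lia.
Qed.

Lemma in_map_lift (L u n : nat) : (0 < u)%nat ->
  In (n mod (L * u))%nat (map (fun i => n mod L + L * i)%nat (seq 0 u)).
Proof.
  intro Hu. rewrite Nat.Div0.mod_mul_r.
  apply (in_map (fun i => n mod L + L * i)%nat), in_seq.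
  pose proof (Nat.mod_upper_bound (n / L) u); lia.
Qed.

Lemma in_lifts (L u K v : nat) (a : Z) (n m k : nat) :
  (0 < u)%nat -> (0 < v)%nat ->
  In (a, n mod (L * u), m mod (L * u), k mod (K * v))%nat
     (lifts L u K v (a, n mod L, m mod L, k mod K)%nat).
Proof.
  intros Hu Hv. cbn [lifts]. repeat apply in_prod;
    (now left) || now apply in_map_lift.
Qed.

(** * Long repdigits *)

(** Boolean form of the criterion, so that a period such as 144 is certified by
    evaluating [pell_terms] once. *)
Lemma pell_period_dec (M : Z) (L : nat) :
  (let P := pell_terms 0 1 (S (S L)) in
   (nth L P 0 mod M =? 0) && ((nth (S L) P 0 - 1) mod M =? 0)
   && negb (M =? 0))%bool = true ->
  forall n, (M | pell (n + L) - pell n).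
Proof.
  cbv zeta. rewrite !nth_pell_table by lia.
  rewrite !Bool.andb_true_iff, Bool.negb_true_iff, !Z.eqb_eq, Z.eqb_neq.
  intros [[H0 H1] HM]. now apply pell_periodic; apply Z.mod_divide.
Qed.

Lemma repunit_period_dec (M : Z) (s K : nat) :
  (((repunit (s + K) - repunit s) mod M =? 0) && negb (M =? 0))%bool = true ->
  forall k, (M | repunit (s + (k + K)) - repunit (s + k)).
Proof.
  rewrite Bool.andb_true_iff, Bool.negb_true_iff, Z.eqb_eq, Z.eqb_neq.
  intros [H HM]. now apply repunit_periodic, Z.mod_divide.
Qed.

Definition first_survivors : list (Z * nat * nat * nat) :=
  [(2%Z, 2, 12, 3); (2%Z, 12, 22, 3); (4%Z, 2, 22, 3); (4%Z, 3, 1, 3);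
   (4%Z, 3, 23, 3); (4%Z, 21, 1, 3); (4%Z, 21, 23, 3)]%nat.

(** Here [9240 = 8 * 3 * 5 * 7 * 11].  The modulus 8 suffices at this stage:
    doubling it would double the period of the Pell sequence. *)
Lemma first_sieve : sieve 9240 24 (classes 24 6) = first_survivors.
Proof. vm_compute. reflexivity. Qed.

(** Here [19856 = 16 * 17 * 73].  The Pell sequence has periods 16, 16 and 72
    modulo the three factors.  The repunits have period 16, but the classes of
    [k] are known modulo 6, whence the common multiple 48. *)
Lemma second_sieve :
  sieve 19856 144 (flat_map (lifts 24 6 6 8) first_survivors) = [].
Proof. vm_compute. reflexivity. Qed.

Lemma no_long_repdigit (a : Z) (n m k : nat) :
  1 <= a <= 9 -> pell n - pell m <> a * repunit (4 + k).
Proof.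
  intros Ha E.
  assert (H1 : In (a, n mod 24, m mod 24, k mod 6)%nat first_survivors).
  { rewrite <- first_sieve. apply sieve_complete; try easy; try lia.
    - apply pell_period_dec. now vm_compute.
    - apply repunit_period_dec. now vm_compute.
    - apply in_classes; lia. }
  assert (H2 : In (a, n mod 144, m mod 144, k mod 48)%nat
                  (sieve 19856 144 (flat_map (lifts 24 6 6 8) first_survivors))).
  { apply sieve_complete; try easy; try lia.
    - apply pell_period_dec. now vm_compute.
    - apply repunit_period_dec. now vm_compute.
    - apply in_flat_map. eexists; split; [exact H1|].
      apply (in_lifts 24 6 6 8); lia. }
  now rewrite second_sieve in H2.
Qed.

(** * Short repdigits *)

Lemma small_difference_index (n m : nat) :
  (m < n)%nat -> pell n - pell m <= 999 -> (n <= 10)%nat.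
Proof.
  intros Hmn H. destruct (Nat.le_gt_cases n 10) as [|Hn]; [assumption|].
  destruct n as [|n]; [lia|].
  (* [pell (S n) - pell m >= pell (S n) - pell n >= pell n >= pell 10] *)
  pose proof (pell_step n). pose proof (pell_mono m n ltac:(lia)).
  pose proof (pell_mono 10 n ltac:(lia)) as H10.
  change (pell 10) with 2378 in H10. lia.
Qed.

Lemma short_differences (a : Z) (n m k : nat) :
  1 <= a <= 9 -> (1 <= k <= 3)%nat -> (1 <= m < n)%nat ->
  pell n - pell m = a * repunit k ->
  In (a * repunit k) [1; 3; 4; 7; 11; 99].
Proof.
  intros Ha Hk Hm E.
  assert (Hn : (n <= 10)%nat).
  { apply (small_difference_index n m); [lia|]. rewrite E.
    assert (k = 1 \/ k = 2 \/ k = 3)%nat as [-> | [-> | ->]] by lia; cbn; lia. }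
  assert (C : forallb (fun a => forallb (fun k => forallb (fun n => forallb (fun m =>
      implb (pell n - pell m =? a * repunit k)
            (existsb (Z.eqb (a * repunit k)) [1; 3; 4; 7; 11; 99]))
      (seq 1 (n - 1))) (seq 1 10)) (seq 1 3)) [1; 2; 3; 4; 5; 6; 7; 8; 9] = true)
    by now vm_compute.
  rewrite forallb_forall in C. specialize (C a ltac:(cbn; lia)).
  rewrite forallb_forall in C. specialize (C k ltac:(apply in_seq; lia)).
  rewrite forallb_forall in C. specialize (C n ltac:(apply in_seq; lia)).
  rewrite forallb_forall in C. specialize (C m ltac:(apply in_seq; lia)).
  rewrite (proj2 (Z.eqb_eq _ _) E) in C. cbn [implb] in C.
  apply existsb_exists in C as (x & Hx & Heq).
  apply Z.eqb_eq in Heq. now rewrite Heq.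
Qed.

Theorem theorem2p2 :
  (forall N : Z,
     repdigit N /\ pell_difference N <-> In N [1; 3; 4; 7; 11; 99]) /\
  pell 2 - pell 1 = 1 /\
  pell 3 - pell 2 = 3 /\
  pell 3 - pell 1 = 4 /\
  pell 4 - pell 3 = 7 /\
  pell 4 - pell 1 = 11 /\
  pell 7 - pell 6 = 99.
Proof.
  split; [|now repeat split].
  intro N; split.
  - intros [Hrep (n & m & Hnm & HN)].
    destruct (repdigit_repunit N Hrep) as (a & k & Ha & Hk & ->).
    destruct (Nat.le_gt_cases k 3) as [Hk3|Hk3].
    + now apply (short_differences a n m k).
    + exfalso. apply (no_long_repdigit a n m (k - 4) Ha).
      rewrite <- HN. now replace (4 + (k - 4))%nat with k by lia.
  - assert (W : forall a k n m,
      1 <= k -> 1 <= a <= 9 -> (1 <= m < n)%nat ->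
      a * ((10 ^ k - 1) / 9) = pell n - pell m ->
      repdigit (pell n - pell m) /\ pell_difference (pell n - pell m)).
    { intros a k n m Hk Ha Hm E; split; [exists a, k | exists n, m]; auto. }
    intros [<-|[<-|[<-|[<-|[<-|[<-|[]]]]]]].
    + apply (W 1 1 2%nat 1%nat); (lia || reflexivity).
    + apply (W 3 1 3%nat 2%nat); (lia || reflexivity).
    + apply (W 4 1 3%nat 1%nat); (lia || reflexivity).
    + apply (W 7 1 4%nat 3%nat); (lia || reflexivity).
    + apply (W 1 2 4%nat 1%nat); (lia || reflexivity).
    + apply (W 9 2 7%nat 6%nat); (lia || reflexivity).
Qed.
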